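(* Let $A,B$ be sets of nonnegative integers that are additive complements, and suppose that $$\limsup_{x\to\infty}\frac{A(x)B(x)}{x}=1+\delta,\qquad\text{where } 0\le \delta< C_0=\tfrac12\left(-3-\sqrt2+\sqrt{3+12\sqrt2}\right)=0.027315\ldots.$$ Then $$\limsup_{x\to\infty}\frac{\log\min\{A(x),B(x)\}}{\log x}\le f(\delta),\qquad\text{where } f(\delta)=\log_2\frac{(2\delta+2)^2}{3-2\delta+\sqrt{(3-2\delta)^2-(2\delta+2)^3}}.$$
   Context: Two sets $A,B$ of nonnegative integers are called additive complements if every sufficiently large integer can be written as $a+b$ with $a\in A$, $b\in B$. For a set $A$ of nonnegative integers, $A(x)$ denotes its counting function, i.e. the number of elements $a\in A$ with $a\le x$. *)

(* Defs.v *)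
From mathcomp Require Import all_boot all_order all_algebra finmap.
From mathcomp Require Import all_classical all_reals all_analysis.

Set Implicit Arguments.
Unset Strict Implicit.
Unset Printing Implicit Defensive.

Import Order.TTheory GRing.Theory Num.Theory.
Import numFieldNormedType.Exports.
Local Open Scope classical_set_scope.
Local Open Scope ring_scope.

Definition additive_complements (A B : set nat) : Prop :=
  \forall n \near \oo, exists a b : nat, [/\ A a, B b & n = (a + b)%N].

(* fset_set sends infinite sets to fset0, but the set below is always finite
   (and empty for x < 0). *)
Definition counting_fun (R : realType) (A : set nat) (x : R) : nat :=
  #|` fset_set [set a : nat | A a /\ a%:R <= x] |%fset.

Definition C0 (R : realType) : R :=
  2^-1 * (- 3 - Num.sqrt 2 + Num.sqrt (3 + 12 * Num.sqrt 2)).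

Definition log2 (R : realType) (x : R) : R := ln x / ln 2.

(* The argument of the square root is positive for 0 <= d <= C0. *)
Definition f_bound (R : realType) (d : R) : R :=
  log2 ((2 * d + 2) ^+ 2 /
        (3 - 2 * d + Num.sqrt ((3 - 2 * d) ^+ 2 - (2 * d + 2) ^+ 3))).

(* Main.v *)
Require Import Defs.
From mathcomp Require Import all_boot all_order all_algebra.
From mathcomp Require Import all_classical all_reals all_analysis.
From mathcomp Require Import finmap zify ring lra.

Import Order.TTheory GRing.Theory Num.Theory.
Import numFieldNormedType.Exports.
Local Open Scope classical_set_scope.
Local Open Scope ring_scope.

(** Put [al = A(2n)/A(n)] and [be = B(2n)/B(n)]. Since [A(n)B(n)] lies between
    [n] and [(1+d)n] up to lower order terms, [al * be <= 2(1+d) + o(1)].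
    Every integer up to [2n] is a sum [a + b] in which [a <= n] or [b <= n], so
    [A(n)B(2n) + A(2n)B(n) - A(n)B(n) >= 2n - O(1)], that is
    [al + be >= 1 + 2/(1+d) - o(1)]. Hence [al] avoids an interval around
    [sqrt(2(1+d))] whose lower end can be taken arbitrarily close to
    [t = 2^f(d)], the smaller root of
    [(2d+2) x^2 - 2(3-2d) x + (2d+2)^2]; the hypothesis [d < C0] makes the
    discriminant positive. As [n] grows, [al] varies too slowly to cross this
    interval, and the same holds for [be]; both cannot stay above it because of
    the bound on [al * be]. So one of the sets, say [A], satisfies
    [A(2n) <= r A(n)] eventually, for each [r > t] close to [t], whence
    [A(x) = O(x^(log2 r))]. *)

(** * Counting pairs behind sums *)

Definition count_upto (A : set nat) (n : nat) : nat :=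
  count (fun i => `[< A i >]) (iota 0 n.+1).

Lemma counting_funE (R : realType) (A : set nat) (x : R) : 0 <= x ->
  counting_fun A x = count_upto A (Num.trunc x).
Proof.
move=> x0; rewrite /counting_fun /count_upto -size_filter.
set s := [seq i <- _ | _].
have -> : [set a | A a /\ a%:R <= x] = [set` [fset a in s]%fset].
  apply/seteqP; split => a /=; rewrite in_fset /= /s mem_filter mem_iota add0n /=.
    by move=> [Aa ax]; rewrite ltnS truncn_ge_nat// ax andbT; apply/asboolP.
  by rewrite ltnS truncn_ge_nat// => /andP[/asboolP].
by rewrite set_fsetK card_fseq undup_id// filter_uniq// iota_uniq.
Qed.

Lemma leq_count_upto (A : set nat) : {homo count_upto A : m n / (m <= n)%N}.
Proof.
move=> m n mn; rewrite /count_upto -(subnKC mn) -addSn iotaD count_cat.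
exact: leq_addr.
Qed.

Lemma count_uptoS (A : set nat) n : (count_upto A n.+1 <= (count_upto A n).+1)%N.
Proof.
rewrite /count_upto -[in X in (X <= _)%N](addn1 n.+1) iotaD count_cat /= addn0.
by rewrite -[in leqRHS]addn1 leq_add2l leq_b1.
Qed.

(** The integers of [[N, n]] are sums of pairs with both entries at most [n], and distinct sums need
    distinct pairs. *)
Lemma count_upto_mul_ge (A B : set nat) (N n : nat) :
  (forall m, (N <= m)%N -> exists a b : nat, [/\ A a, B b & m = (a + b)%N]) ->
  (n.+1 <= N + count_upto A n * count_upto B n)%N.
Proof.
move=> hAB; rewrite -leq_subLR /count_upto -!size_filter -(size_allpairs addn).
rewrite -[in X in (X <= _)%N](size_iota N (n.+1 - N)).
apply: uniq_leq_size; first exact: iota_uniq.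
move=> m; rewrite mem_iota => /andP[Nm mn].
have [a [b [Aa Bb mab]]] := hAB _ Nm.
apply/allpairsP; exists (a, b); split => //; rewrite mem_filter mem_iota /=;
  apply/andP; split; try exact/asboolP; lia.
Qed.

(* A sum [a + b <= 2 n] has [a <= n] or [b <= n]. *)
Lemma count_upto_cross_ge (A B : set nat) (N n : nat) :
  (forall m, (N <= m)%N -> exists a b : nat, [/\ A a, B b & m = (a + b)%N]) ->
  (n.*2.+1 + count_upto A n * count_upto B n <=
   N + (count_upto A n * count_upto B n.*2 +
        count_upto A n.*2 * count_upto B n))%N.
Proof.
move=> hAB.
pose s X i j := [seq k <- iota i j | `[< X k >]].
have sE X i j : size (s X i j) = count (fun k => `[< X k >]) (iota i j).
  by rewrite size_filter.
have A2 : count_upto A n.*2 = (count_upto A n + size (s A n.+1 n))%N.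
  by rewrite /count_upto sE -addnn -addSn iotaD count_cat.
(* Pairs with [a <= n], [b <= 2n] and pairs with [n < a <= 2n], [b <= n] suffice; adding [A(n)B(n)]
   completes the second product to [A(2n)B(n)]. *)
suff : (n.*2.+1 - N <= count_upto A n * count_upto B n.*2 +
                       size (s A n.+1 n) * count_upto B n)%N.
  by rewrite A2 mulnDl; lia.
rewrite /count_upto -!sE -!(size_allpairs addn) -size_cat.
rewrite -[in X in (X <= _)%N](size_iota N (n.*2.+1 - N)).
apply: uniq_leq_size; first exact: iota_uniq.
move=> m; rewrite mem_iota => /andP[Nm mn].
have [a [b [Aa Bb mab]]] := hAB _ Nm.
rewrite mem_cat; apply/orP; case: (leqP a n) => an; [left|right];
  apply/allpairsP; exists (a, b); split => //; rewrite mem_filter mem_iota /=;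
  apply/andP; split; try exact/asboolP; lia.
Qed.

(** * The forbidden interval for doubling ratios *)

(* With [al = a'/a] and [be = b'/b] the hypotheses bound [al + be] from below
   and [al * be] from above, hence [al] satisfies the opposite quadratic
   inequality. *)
Lemma quotient_gap (R : realFieldType) (a a' b b' n K e r s : R) :
  0 < a -> 0 < b -> 0 < n -> 0 < K -> 0 < e < 1 ->
  (1 - e) * n <= a * b -> a * b <= K * n -> a' * b' <= 2 * K * n ->
  (2 - e) * n <= a * b' + a' * b - a * b ->
  K * (1 - e) * r ^+ 2 - (K + 2 - e) * (1 - e) * r + 2 * K ^+ 2 < 0 ->
  K * (1 - e) * s ^+ 2 - (K + 2 - e) * (1 - e) * s + 2 * K ^+ 2 < 0 ->
  ~ (r * a <= a' <= s * a).
Proof.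
move=> a0 b0 n0 K0 /andP[e0 e1] ab1 ab2 ab' cross Gr Gs /andP[ra as_].
pose al := a' / a; pose be := b' / b.
have a'E : a' = al * a by rewrite /al divfK// gt_eqF.
have b'E : b' = be * b by rewrite /be divfK// gt_eqF.
have ral : r <= al by rewrite /al ler_pdivlMr.
have als : al <= s by rewrite /al ler_pdivrMr.
have ab0 : 0 < a * b by rewrite mulr_gt0.
have sumP : K + 2 - e <= K * (al + be).
  rewrite -(ler_pM2r n0).
  have -> : (K + 2 - e) * n = K * n + (2 - e) * n by ring.
  move: cross; rewrite a'E b'E.
  have -> : a * (be * b) + al * a * b - a * b = (al + be - 1) * (a * b) by ring.
  move=> cross.
  (* Positivity of this factor allows [a * b] to be replaced by its upper bound [K * n]. *)
  have h1 : 0 < al + be - 1.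
    by rewrite -(pmulr_lgt0 _ ab0); apply: lt_le_trans cross; rewrite mulr_gt0//; lra.
  have := ler_wpM2l (ltW h1) ab2; nra.
have prodP : (1 - e) * (al * be) <= 2 * K.
  rewrite -(ler_pM2r n0); move: ab'; rewrite a'E b'E.
  have -> : al * a * (be * b) = (al * be) * (a * b) by ring.
  move=> ab'; have [ge|lt] := leP 0 (al * be).
    by have := ler_wpM2l ge ab1; nra.
  apply: (@le_trans _ _ 0); last by rewrite !mulr_ge0// ltW.
  by rewrite pmulr_lle0// mulr_ge0_le0// ?ltW// subr_gt0.
have c0 : 0 < K * (1 - e) by rewrite mulr_gt0// subr_gt0.
(* For [al >= 0], multiply [sumP] by [(1 - e) * al] and bound [al * be] by [prodP]; for [al < 0] no
   term is negative. *)
have key : 0 <= K * (1 - e) * al ^+ 2 - (K + 2 - e) * (1 - e) * al + 2 * K ^+ 2.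
  have [al0|al0] := leP 0 al.
    have h1 : (1 - e) * al * (K + 2 - e) <= (1 - e) * al * (K * (al + be)).
      by apply: ler_wpM2l => //; rewrite mulr_ge0// subr_ge0 ltW.
    have h2 := ler_wpM2l (ltW K0) prodP; nra.
  have : 0 <= K * (1 - e) * al ^+ 2 by rewrite mulr_ge0 ?sqr_ge0// ltW.
  have : 0 <= (K + 2 - e) * (1 - e) * (- al).
    by rewrite !mulr_ge0//; lra.
  nra.
have : 0 <= K * (1 - e) * ((al - r) * (s - al)).
  by rewrite !mulr_ge0// ?subr_ge0// ltW.
have [rs|rs] := eqVneq r s.
  have alr : al = r by apply/eqP; rewrite eq_le ral rs als.
  by move: key; rewrite alr; lra.
have rs0 : 0 < s - r by rewrite subr_gt0 lt_neqAle rs (le_trans ral).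
(* [G] is convex and negative at [r] and [s], hence negative between them; the identity below is
   linear interpolation with its exact remainder. *)
pose G x := K * (1 - e) * x ^+ 2 - (K + 2 - e) * (1 - e) * x + 2 * K ^+ 2.
move=> conc.
have : (s - r) * G al = (s - al) * G r + (al - r) * G s
         - (s - r) * (K * (1 - e) * ((al - r) * (s - al))).
  by rewrite /G; ring.
have : 0 <= (s - r) * (K * (1 - e) * ((al - r) * (s - al))).
  by rewrite mulr_ge0// ltW.
have : (s - al) * G r + (al - r) * G s < 0.
  have [alr|alr] := eqVneq al r.
    rewrite alr subrr mul0r addr0 pmulr_rlt0//.
  have : 0 < al - r by rewrite subr_gt0 lt_neqAle eq_sym alr.
  move=> h; rewrite ltr_wnDl//; last by rewrite pmulr_rlt0.
  by rewrite mulr_ge0_le0// ?subr_ge0// ltW.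
have : 0 <= (s - r) * G al by rewrite mulr_ge0 ?(ltW rs0).
lra.
Qed.

(* The ratio [u n.*2 / u n] moves by less than [s - r] once [u n] is large, so
   it cannot jump over the forbidden interval [[r, s]]. *)
Lemma doubling_dichotomy (R : realType) (u : nat -> nat) (r s : R) (N0 : nat) :
  {homo u : m n / (m <= n)%N} -> (forall n, (u n.+1 <= (u n).+1)%N) ->
  1 < r < s -> (forall n, (N0 <= n)%N -> (0 < u n)%N) ->
  (forall n, (N0 <= n)%N ->
     ~ (r * (u n)%:R <= (u n.*2)%:R <= s * (u n)%:R)) ->
  (exists N, forall n, (N <= n)%N -> (u n.*2)%:R < r * (u n)%:R) \/
  (exists N, forall n, (N <= n)%N -> s * (u n)%:R < (u n.*2)%:R).
Proof.
move=> uh uS /andP[r1 rs] u0 gap.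
(* A bounded [u] is eventually constant, so its doubling ratio is [1 < r]. *)
have [[M ubM]|unb] := pselect (exists M, forall n, (u n <= M)%N).
  left.
  pose P k := `[< exists n, (N0 <= n)%N /\ u n = k >].
  have exP : exists k, P k by exists (u N0); apply/asboolP; exists N0.
  have leP k : P k -> (k <= M)%N by move=> /asboolP[n [_ <-]].
  case: (ex_maxnP exP leP) => m /asboolP[n0 [Nn0 um]] max.
  have cst n : (n0 <= n)%N -> u n = m.
    move=> n0n; apply/eqP; rewrite eqn_leq -{2}um uh// andbT max//.
    by apply/asboolP; exists n; split => //; exact: leq_trans n0n.
  exists n0 => n n0n; rewrite !cst//; last by lia.
  have : (0 : R) < m%:R by rewrite ltr0n -(cst _ n0n) u0// (leq_trans Nn0).
  by move=> m0; rewrite ltr_pMl.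
have [N1 hN1] : exists N1, 2 / (s - r) <= (u N1)%:R :> R.
  apply: contrapT => /forallNP h; apply: unb.
  exists (Num.trunc (2 / (s - r))) => n.
  rewrite truncn_ge_nat ?divr_ge0// ?subr_ge0 ?(ltW rs)//.
  by rewrite ltW// ltNge; apply/negP/h.
pose N := maxn N0 N1.
(* [u(2n+2) <= u(2n) + 2 < r u(n) + (s - r) u(n) <= s u(n+1)], and the gap then forces
   [u(2n+2) < r u(n+1)]. *)
have step n : (N <= n)%N -> (u n.*2)%:R < r * (u n)%:R ->
    (u n.+1.*2)%:R < r * (u n.+1)%:R.
  rewrite geq_max => /andP[N0n N1n] un.
  have un1 : 2 / (s - r) <= (u n)%:R :> R.
    by rewrite (le_trans hN1)// ler_nat uh.
  have un2 : 2 <= (s - r) * (u n)%:R.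
    by move: un1; rewrite ler_pdivrMr ?subr_gt0// mulrC.
  have unS : (u n)%:R <= (u n.+1)%:R :> R by rewrite ler_nat uh.
  have u2 : (u n.+1.*2)%:R <= (u n.*2)%:R + 2 :> R.
    by rewrite -natrD ler_nat doubleS; have := uS n.*2; have := uS n.*2.+1; lia.
  have hs : (u n.+1.*2)%:R <= s * (u n.+1)%:R.
    have s0 : 0 <= s by lra.
    by have := ler_wpM2l s0 unS; lra.
  rewrite ltNge; apply/negP => hr.
  by apply: (gap n.+1); [exact: leqW|rewrite hr hs].
have [[n [Nn un]]|none] :=
    pselect (exists n, (N <= n)%N /\ (u n.*2)%:R < r * (u n)%:R).
  left; exists n => m nm; rewrite -(subnKC nm).
  elim: (m - n)%N => [|k IH]; first by rewrite addn0.
  by rewrite addnS; apply: step => //; lia.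
right; exists N => n Nn; rewrite ltNge; apply/negP => hs.
have [hr|hr] := leP (r * (u n)%:R) (u n.*2)%:R.
  by apply: (gap n); [move: Nn; rewrite /N; lia|rewrite hr hs].
by apply: none; exists n.
Qed.

(** * From doubling bounds to logarithmic growth *)

(** Iterating from [N] costs a factor [r ^+ k] at [2 ^ k * N]; for [k = (trunc_log 2 n).+1] this
    point lies beyond [n]. *)
Lemma doubling_growth (R : realType) (u : nat -> nat) (r : R) (N : nat) :
  {homo u : m n / (m <= n)%N} -> 1 <= r -> (0 < N)%N ->
  (forall n, (N <= n)%N -> (u n.*2)%:R <= r * (u n)%:R) ->
  forall n, (0 < n)%N ->
    (u n)%:R <= r ^+ (trunc_log 2 n).+1 * (u N)%:R.
Proof.
move=> uh r1 N0 db n n0.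
have r0 : 0 <= r by lra.
have pow k : (u (2 ^ k * N)%N)%:R <= r ^+ k * (u N)%:R.
  elim: k => [|k IH]; first by rewrite expn0 mul1n expr0 mul1r.
  rewrite expnS -mulnA mul2n exprS -mulrA.
  apply: le_trans (db _ _) _; last exact: ler_wpM2l.
  by rewrite leq_pmull// expn_gt0.
apply: le_trans (pow _); rewrite ler_nat uh//.
have /andP[_ lt] := trunc_log_bounds (isT : (1 < 2)%N) n0.
by rewrite (leq_trans (ltnW lt))// leq_pmulr.
Qed.

(** The growth bound gives [log2 r * ln x] plus a constant. Only [g <= u] is asked, so that a
    minimum can be compared with either of its members. *)
Lemma limf_esup_log_le (R : realType) (u : nat -> nat) (g : R -> nat) (r : R)
    (N : nat) :
  {homo u : m n / (m <= n)%N} -> 1 <= r -> (0 < N)%N ->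
  (forall n, (N <= n)%N -> (u n.*2)%:R <= r * (u n)%:R) ->
  (forall x, 0 <= x -> (g x <= u (Num.trunc x))%N) ->
  (limf_esup (fun x : R => (ln (g x)%:R / ln x)%:E) (pinfty_nbhs R) <=
   (log2 r)%:E)%E.
Proof.
move=> uh r1 N0 db gu; apply/lee_addgt0Pr => e e0.
pose C : R := ln r + ln (u N)%:R.
(* Beyond [expR (C / e)] the constant [C] is less than [e * ln x]; the [2] keeps [ln x] positive. *)
pose M : R := Num.max 2 (expR (C / e)).
apply: (@le_trans _ _ (ereal_sup
  [set (ln (g x)%:R / ln x)%:E | x in [set x : R | M < x]])).
  apply: ereal_inf_lbound; exists [set x : R | M < x] => //.
  by apply: nbhs_pinfty_gt; exact: num_real.
apply: ge_ereal_sup => _ [x /= Mx <-].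
rewrite -EFinD lee_fin.
have x2 : 2 < x by apply: le_lt_trans Mx; rewrite le_max lexx.
have xC : expR (C / e) < x by apply: le_lt_trans Mx; rewrite le_max lexx orbT.
have x0 : 0 < x by lra.
have lx0 : 0 < ln x by rewrite ln_gt0; lra.
have l20 : 0 < ln 2 :> R by rewrite ln_gt0; lra.
have lr0 : 0 <= ln r by rewrite ln_ge0.
have CM : C < e * ln x.
  by rewrite mulrC -ltr_pdivrMr// -[X in X < _]expRK ltr_ln// posrE expR_gt0.
rewrite ler_pdivrMr// mulrDl.
(* If [g x = 0], the convention [ln 0 = 0] applies and the right-hand side is nonnegative. *)
have [g0|g0] := posnP (g x).
  by rewrite g0 ln0// addr_ge0// mulr_ge0 ?divr_ge0 ?(ltW lx0) ?(ltW l20) ?(ltW e0).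
set n := Num.trunc x.
have gn := gu _ (ltW x0).
have n0 : (0 < n)%N by rewrite /n truncn_gt0; lra.
have un : (0 < u n)%N by exact: leq_trans g0 gn.
have grow := doubling_growth _ _ _ _ uh r1 N0 db _ n0.
have uN : (0 < u N)%N.
  rewrite lt0n; apply/eqP => uN0; move: grow.
  by rewrite uN0 mulr0 lern0 -leqn0 leqNgt un.
set k := trunc_log 2 n.
have kln : k%:R * ln 2 <= ln x.
  rewrite mulr_natl -lnXn// ler_ln ?posrE ?exprn_gt0//.
  rewrite -natrX; apply: (@le_trans _ _ n%:R).
    by rewrite ler_nat; have /andP[] := trunc_log_bounds (isT : (1 < 2)%N) n0.
  by rewrite /n truncn_le ltW.
have lnu : ln (g x)%:R <= k%:R * ln r + C.
  have r0 : 0 < r by lra.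
  apply: (@le_trans _ _ (ln (r ^+ k.+1 * (u N)%:R))).
    rewrite ler_ln ?posrE ?ltr0n ?mulr_gt0 ?exprn_gt0 ?ltr0n//.
    by apply: le_trans grow; rewrite ler_nat.
  rewrite lnM ?posrE ?exprn_gt0 ?ltr0n// lnXn// mulrS /C -mulr_natl; lra.
have : k%:R * ln r <= log2 r * ln x.
  rewrite /log2 mulrAC ler_pdivlMr// mulrAC [_ * ln r]mulrC.
  exact: ler_wpM2l.
lra.
Qed.

(** * The quadratic behind [f_bound], and room for error terms *)

(** [t] is the smaller root [(h - sqrt D) / q] in rationalized form. The two roots have product [q],
    so a point between [t] and [sqrt q] lies between the roots. *)
Lemma f_bound_quadratic (R : realType) (d : R) : 0 <= d -> d < C0 R ->
  let q := 2 * d + 2 in let h := 3 - 2 * d in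
  let t := q ^+ 2 / (h + Num.sqrt (h ^+ 2 - q ^+ 3)) in
  [/\ 1 <= t, t ^+ 2 < q &
      forall r, t < r -> r ^+ 2 < q -> q * r ^+ 2 - 2 * h * r + q ^+ 2 < 0].
Proof.
move=> d0 dC q h t.
set D := h ^+ 2 - q ^+ 3 in t *.
have w2 : Num.sqrt 2 ^+ 2 = 2 :> R by rewrite sqr_sqrtr.
have w0 : 0 < Num.sqrt 2 :> R by rewrite sqrtr_gt0.
move: dC; rewrite /C0.
set w : R := Num.sqrt 2 in w2 w0 *.
set z : R := Num.sqrt (3 + 12 * w) => dC.
have z2 : z ^+ 2 = 3 + 12 * w by rewrite sqr_sqrtr//; lra.
have z0 : 0 <= z by rewrite sqrtr_ge0.
(* [C0] is the positive root of [(2d + 2)(d + 2) = sqrt 2 * (3 - 2d)]. *)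
have lin : (2 * d + 2) * (d + 2) < w * (3 - 2 * d).
  have : 0 <= 2 * d + 3 + w by lra.
  have : 2 * d + 3 + w < z by lra.
  nra.
have h0 : 0 < h.
  rewrite -(pmulr_rgt0 _ w0); apply: le_lt_trans lin.
  by rewrite mulr_ge0; lra.
(* Squaring [lin] gives [2 h^2 > q^2 (d + 2)^2 >= 2 q^3], because [(d + 2)^2 >= 4d + 4 = 2q]. *)
have D0 : 0 < D.
  have : ((2 * d + 2) * (d + 2)) ^+ 2 < (w * h) ^+ 2.
    by rewrite ltr_pXn2r// nnegrE; [rewrite mulr_ge0; lra|rewrite mulr_ge0// ltW].
  rewrite !exprMn w2 /D /q; nra.
pose v : R := Num.sqrt D.
have v0 : 0 < v by rewrite sqrtr_gt0.
have v2 : v ^+ 2 = h ^+ 2 - q ^+ 3 by rewrite sqr_sqrtr// ltW.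
have q0 : 2 <= q by rewrite /q; lra.
have hv0 : 0 < h + v by lra.
have tE : t * (h + v) = q ^+ 2 by rewrite /t divfK// gt_eqF.
have t0 : 0 < t by rewrite divr_gt0// exprn_gt0//; lra.
have root : q * t = h - v.
  apply: (mulIf (lt0r_neq0 hv0)); rewrite -mulrA tE.
  have -> : (h - v) * (h + v) = h ^+ 2 - v ^+ 2 by ring.
  by rewrite v2; ring.
have tq : t ^+ 2 < q.
  have : q * t * t < (h + v) * t by rewrite ltr_pM2r//; lra.
  rewrite [(h + v) * t]mulrC tE; nra.
split => //.
  rewrite ler_pdivlMr// mul1r -lerBrDl.
  have v1 : v <= 1.
    rewrite -(@ler_pXn2r _ 2)// ?nnegrE ?(ltW v0)// expr1n v2 /h /q; nra.
  rewrite (le_trans v1)// /h /q; nra.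
move=> r tr rq.
have r0 : 0 < r by exact: lt_trans tr.
have -> : q * r ^+ 2 - 2 * h * r + q ^+ 2 = (r - t) * (q * r - (h + v)).
  have -> : (r - t) * (q * r - (h + v)) =
     q * r ^+ 2 - (q * t) * r - (h + v) * r + t * (h + v) by ring.
  by rewrite root tE; ring.
rewrite pmulr_rlt0 ?subr_gt0// subr_lt0 -(ltr_pM2r t0) [(h + v) * t]mulrC tE.
have : r * t < r * r by rewrite ltr_pM2l.
by nra.
Qed.

Lemma horner_lt0_near_right (R : realType) (p : {poly R}) : p.[0] < 0 ->
  \forall e \near 0^'+, p.[e] < 0.
Proof.
by apply: cvgr_lt; apply: cvg_at_right_filter; exact: continuous_horner.
Qed.

(** Strict inequalities at slack zero persist for small [e > 0], by continuity of polynomials in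
    [e]. *)
Lemma exists_slack (R : realType) (d r s : R) :
  (1 + d) * r ^+ 2 - (3 + d) * r + 2 * (1 + d) ^+ 2 < 0 ->
  (1 + d) * s ^+ 2 - (3 + d) * s + 2 * (1 + d) ^+ 2 < 0 ->
  2 * (1 + d) < s ^+ 2 ->
  exists e, let K := 1 + d + e in
  [/\ 0 < e < 1,
      K * (1 - e) * r ^+ 2 - (K + 2 - e) * (1 - e) * r + 2 * K ^+ 2 < 0,
      K * (1 - e) * s ^+ 2 - (K + 2 - e) * (1 - e) * s + 2 * K ^+ 2 < 0 &
      2 * K < (1 - e) * s ^+ 2].
Proof.
move=> Gr Gs qs.
(* The indeterminate is the slack, not [x]; [K + 2 - e] collapses to the constant [3 + d]. *)
pose P (x : R) : {poly R} := ((1 + d)%:P + 'X) * (1 - 'X) * (x ^+ 2)%:P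
  - (3 + d)%:P * (1 - 'X) * x%:P + 2%:P * ((1 + d)%:P + 'X) ^+ 2.
pose Q : {poly R} := 2%:P * ((1 + d)%:P + 'X) - (1 - 'X) * (s ^+ 2)%:P.
have PE x e : (P x).[e] = (1 + d + e) * (1 - e) * x ^+ 2
    - (3 + d) * (1 - e) * x + 2 * (1 + d + e) ^+ 2.
  by rewrite /P !hornerE.
have QE e : Q.[e] = 2 * (1 + d + e) - (1 - e) * s ^+ 2 by rewrite /Q !hornerE.
have nP x : (1 + d) * x ^+ 2 - (3 + d) * x + 2 * (1 + d) ^+ 2 < 0 ->
    \forall e \near 0^'+, (P x).[e] < 0.
  by move=> Gx; apply: horner_lt0_near_right; rewrite PE addr0 subr0 !mulr1.
have nQ : \forall e \near 0^'+, Q.[e] < 0.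
  by apply: horner_lt0_near_right; rewrite QE addr0 subr0 mul1r subr_lt0.
have e1 : \forall e \near 0^'+, e < (1 : R) by exact: nbhs_right_lt.
have e0 : \forall e \near 0^'+, (0 : R) < e by exact: nbhs_right_gt.
have [e [[[[Pr Ps] Qe] lt1] gt0]] := filter_ex
  (filterI (filterI (filterI (filterI (nP _ Gr) (nP _ Gs)) nQ) e1) e0).
exists e => K; rewrite gt0 lt1; split => //.
- by move: Pr; rewrite PE /K; lra.
- by move: Ps; rewrite PE /K; lra.
- by move: Qe; rewrite QE /K; lra.
Qed.

(** * Slow doubling of one of the two complements *)

Lemma product_count_le (R : realType) (A B : set nat) (l e : R) :
  limf_esup
     (fun x : R => ((counting_fun A x)%:R * (counting_fun B x)%:R / x)%:E)
     (pinfty_nbhs R) = l%:E ->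
  0 < e ->
  exists N, forall n, (N <= n)%N ->
    (count_upto A n)%:R * (count_upto B n)%:R <= (l + e) * n%:R.
Proof.
move=> hl e0.
have : (limf_esup
     (fun x : R => ((counting_fun A x)%:R * (counting_fun B x)%:R / x)%:E)
     (pinfty_nbhs R) < (l + e)%:E)%E by rewrite hl lte_fin ltrDl.
move=> /ereal_inf_lt[_ [V [M [_ MV]] <-] ltV].
exists (Num.trunc `|M|).+1 => n Mn.
have lMn : `|M| < n%:R by rewrite -truncn_lt_nat.
have n0 : 0 < n%:R :> R by exact: le_lt_trans lMn.
have Vn : V n%:R by apply: MV; exact: le_lt_trans (ler_norm M) lMn.
have : (((counting_fun A (n%:R : R))%:R * (counting_fun B (n%:R : R))%:R / n%:R)%R%:E
    < (l + e)%:E)%E.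
  move: ltV; apply: le_lt_trans; apply: ereal_sup_ubound.
  by exists n%:R.
rewrite !counting_funE// natrK lte_fin ltr_pdivrMr//.
exact: ltW.
Qed.

Lemma complements_doubling (R : realType) (A B : set nat) (d r : R) :
  additive_complements A B ->
  limf_esup
     (fun x : R => ((counting_fun A x)%:R * (counting_fun B x)%:R / x)%:E)
     (pinfty_nbhs R) = (1 + d)%:E ->
  0 <= d -> 1 < r -> r ^+ 2 < 2 * d + 2 ->
  (2 * d + 2) * r ^+ 2 - 2 * (3 - 2 * d) * r + (2 * d + 2) ^+ 2 < 0 ->
  (exists N, forall n, (N <= n)%N ->
     (count_upto A n.*2)%:R < r * (count_upto A n)%:R) \/
  (exists N, forall n, (N <= n)%N ->
     (count_upto B n.*2)%:R < r * (count_upto B n)%:R).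
Proof.
move=> [c _ hAB] hl d0 r1 rq quad.
have r0 : 0 < r by lra.
(* With [q = 2 * d + 2], the quadratic keeps its sign under [x -> q / x] for [x > 0], since its
   roots have product [q]. So it is negative at [s] too, and [[r, s]] is the forbidden interval. *)
pose s := (2 * d + 2) / r.
have sr : s * r = 2 * d + 2 by rewrite /s divfK// gt_eqF.
have rs : r < s by rewrite ltr_pdivlMr// -expr2.
have s0 : 0 < s by lra.
have sq : 2 * (1 + d) < s ^+ 2.
  by have : r * s < s * s by [rewrite ltr_pM2r|]; lra.
have quads : (2 * d + 2) * s ^+ 2 - 2 * (3 - 2 * d) * s + (2 * d + 2) ^+ 2 < 0.
  have r20 : 0 < r ^+ 2 by rewrite exprn_gt0.
  rewrite -(pmulr_rlt0 _ r20).
  have -> : r ^+ 2 * ((2 * d + 2) * s ^+ 2 - 2 * (3 - 2 * d) * s + (2 * d + 2) ^+ 2)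
     = (2 * d + 2) * (s * r) ^+ 2 - 2 * (3 - 2 * d) * (s * r) * r
       + (2 * d + 2) ^+ 2 * r ^+ 2 by ring.
  rewrite sr.
  have -> : (2 * d + 2) * (2 * d + 2) ^+ 2 - 2 * (3 - 2 * d) * (2 * d + 2) * r
       + (2 * d + 2) ^+ 2 * r ^+ 2
     = (2 * d + 2) * ((2 * d + 2) * r ^+ 2 - 2 * (3 - 2 * d) * r
       + (2 * d + 2) ^+ 2) by ring.
  by rewrite pmulr_rlt0//; lra.
have [||e [/andP[e0 e1] Gr Gs Ks]] := exists_slack R d r s _ _ sq.
(* Half of [quad] has linear coefficient [3 - 2d]; passing to [3 + d] only subtracts [3 * d * r].
   The same is done for [s]. *)
- by have : 0 <= d * r by [rewrite mulr_ge0// ltW|]; nra.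
- by have : 0 <= d * s by [rewrite mulr_ge0// ltW|]; nra.
set K := 1 + d + e in Gr Gs Ks.
have K0 : 0 < K by rewrite /K; lra.
have [N1 hN1] := product_count_le _ _ _ _ _ hl e0.
(* Past [c / e], the possibly unrepresented integers below [c] cost at most [e * n]. *)
pose N0 := maxn (maxn 1 N1) (Num.trunc (c%:R / e)).+1.
have est n : (N0 <= n)%N ->
    [/\ 0 < n%:R :> R,
        (1 - e) * n%:R <= (count_upto A n)%:R * (count_upto B n)%:R,
        (count_upto A n)%:R * (count_upto B n)%:R <= K * n%:R,
        (count_upto A n.*2)%:R * (count_upto B n.*2)%:R <= 2 * K * n%:R &
        (2 - e) * n%:R <= (count_upto A n)%:R * (count_upto B n.*2)%:R
          + (count_upto A n.*2)%:R * (count_upto B n)%:R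
          - (count_upto A n)%:R * (count_upto B n)%:R].
  rewrite /N0 !geq_max => /andP[/andP[n1 N1n] cn].
  have cen : c%:R <= e * n%:R.
    rewrite mulrC -ler_pdivrMr// ltW// -truncn_lt_nat//.
    by rewrite divr_ge0// ltW.
  have n0 : 0 < n%:R :> R by rewrite ltr0n.
  split => //.
  - have := count_upto_mul_ge A B c n hAB.
    rewrite -(ler_nat R) natrD natrM -natr1; lra.
  - exact: hN1.
  - have n2 : (N1 <= n.*2)%N by apply: (leq_trans N1n); rewrite -addnn leq_addr.
    by have := hN1 _ n2; rewrite -/K -[in n.*2%:R]muln2 natrM; lra.
  - have := count_upto_cross_ge A B c n hAB.
    have n2 : n.*2.+1%:R = 2 * n%:R + 1 :> R by rewrite -natr1 -muln2 natrM mulrC.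
    by rewrite -(ler_nat R) 3!natrD n2 !natrM; lra.
have pos n : (N0 <= n)%N -> (0 < count_upto A n)%N /\ (0 < count_upto B n)%N.
  move=> /est[n0 ab _ _ _]; apply/andP; rewrite -muln_gt0 -(ltr0n R) natrM.
  by apply: lt_le_trans ab; rewrite mulr_gt0// subr_gt0.
have e01 : 0 < e < 1 by rewrite e0.
have r1s : 1 < r < s by rewrite r1.
have [||[N hA]|[NA hA]] := doubling_dichotomy _ (count_upto A) r s N0
  (leq_count_upto A) (count_uptoS A) r1s.
- by move=> n /pos[].
- move=> n Nn; have [a0 b0] := pos _ Nn; have [n0 ab1 ab2 ab3 ab4] := est _ Nn.
  by apply: (quotient_gap _ _ _ (count_upto B n)%:R (count_upto B n.*2)%:R
    n%:R K e) => //; rewrite ltr0n.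
- by left; exists N.
have [||[N hB]|[NB hB]] := doubling_dichotomy _ (count_upto B) r s N0
  (leq_count_upto B) (count_uptoS B) r1s.
- by move=> n /pos[].
- move=> n Nn; have [a0 b0] := pos _ Nn; have [n0 ab1 ab2 ab3 ab4] := est _ Nn.
  by apply: (quotient_gap _ _ _ (count_upto A n)%:R (count_upto A n.*2)%:R
    n%:R K e) => //; rewrite ?ltr0n// ![(count_upto B _)%:R * _]mulrC //; lra.
- by right; exists N.
(* If both ratios exceeded [s], then [A(2n)B(2n) > s^2 (1 - e) n > 2 K n], against the upper bound
   on the product. *)
pose n := maxn N0 (maxn NA NB).
have Nn : (N0 <= n)%N by rewrite leq_maxl.
have /hA lA : (NA <= n)%N by rewrite /n !leq_max leqnn orbT.
have /hB lB : (NB <= n)%N by rewrite /n !leq_max leqnn !orbT.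
have [n0 ab1 _ ab3 _] := est _ Nn.
have prod : s * (count_upto A n)%:R * (s * (count_upto B n)%:R) <
    (count_upto A n.*2)%:R * (count_upto B n.*2)%:R.
  by apply: ltr_pM => //; rewrite mulr_ge0// ltW.
have : (1 - e) * s ^+ 2 * n%:R <= s ^+ 2 * ((count_upto A n)%:R * (count_upto B n)%:R).
  by rewrite [_ * s ^+ 2]mulrC -mulrA ler_wpM2l// sqr_ge0.
have : 2 * K * n%:R < (1 - e) * s ^+ 2 * n%:R by rewrite ltr_pM2r.
lra.
Qed.

Theorem theorem1 (R : realType) (A B : set nat) (delta : R)
  (hAB : additive_complements A B)
  (hlimsup : limf_esup
     (fun x : R => ((counting_fun A x)%:R * (counting_fun B x)%:R / x)%:E)
     (pinfty_nbhs R) = (1 + delta)%:E)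
  (hdelta0 : 0 <= delta)
  (hdelta : delta < C0 R) :
  (limf_esup
     (fun x : R =>
        (ln (minn (counting_fun A x) (counting_fun B x))%:R / ln x)%:E)
     (pinfty_nbhs R) <= (f_bound delta)%:E)%E.
Proof.
have [] := f_bound_quadratic _ _ hdelta0 hdelta.
set t := (_ / _) => t1 tq quad.
have dbl r := complements_doubling _ _ _ _ r hAB hlimsup hdelta0.
clear hlimsup.
have t0 : 0 < t by lra.
have l20 : 0 < ln 2 :> R by rewrite ln_gt0// ltr1n.
apply/lee_addgt0Pr => e e0.
pose w := Num.sqrt (2 * delta + 2).
have w0 : 0 <= w by exact: sqrtr_ge0.
have w2 : w ^+ 2 = 2 * delta + 2 by rewrite sqr_sqrtr; lra.
have tw : t < w by rewrite -(@ltr_pXn2r _ 2) ?w2 ?nnegrE ?(ltW t0).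
(* The first bound gives [log2 r <= log2 t + e]; the midpoint keeps [r] below [w], hence between the
   roots. *)
pose r := Num.min (t * expR (e * ln 2)) ((t + w) / 2).
have tr : t < r.
  rewrite lt_min; apply/andP; split; last by lra.
  by rewrite ltr_pMr// expR_gt1 mulr_gt0.
have rw : r < w by rewrite gt_min; apply/orP; right; lra.
have rq : r ^+ 2 < 2 * delta + 2.
  by rewrite -w2 ltr_pXn2r// nnegrE; lra.
have r1 : 1 < r by lra.
have r0 : 0 < r by lra.
have te0 : 0 < t * expR (e * ln 2) by exact: mulr_gt0 t0 (expR_gt0 _).
have log_r : log2 r <= f_bound delta + e.
  rewrite /log2 ler_pdivrMr// mulrDl /f_bound -/t /log2 divfK ?gt_eqF//.
  rewrite -[X in _ <= _ + X]expRK -lnM ?posrE ?expR_gt0//.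
  by rewrite ler_ln ?posrE// /r ?ge_min ?lexx.
apply: (@le_trans _ _ (log2 r)%:E); last by rewrite -EFinD lee_fin.
(* Whichever set doubles slowly bounds the minimum; [N.+1] is the positive starting point required
   for the iteration. *)
have [[N hN]|[N hN]] := dbl _ r1 rq (quad _ tr rq);
  [apply: (limf_esup_log_le _ (count_upto A) _ _ N.+1 (leq_count_upto A))
  |apply: (limf_esup_log_le _ (count_upto B) _ _ N.+1 (leq_count_upto B))] => //.
- exact: ltW.
- by move=> n Nn; rewrite ltW// hN// ltnW.
- by move=> x x0; rewrite -counting_funE// geq_minl.
- exact: ltW.
- by move=> n Nn; rewrite ltW// hN// ltnW.
- by move=> x x0; rewrite -counting_funE// geq_minr.
Qed.
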